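(* Let $M$ be a matroid on $T$ with rank function $\operatorname{rk}$, and let $M_1,M_2$ be extensions of $M$ with ground sets $E_1,E_2$ and rank functions $\operatorname{rk}_1,\operatorname{rk}_2$, where $E_1\cap E_2=T$, $E=E_1\cup E_2$, and all these matroids have finite rank and finite or countably infinite ground sets. Define $\eta,\xi$ and $\mathcal{L}(M_1,M_2)$ as below. Assume that for every pair $(X,Y)$ of elements of $\mathcal{L}(M_1,M_2)$, at least one of $f=\eta$ or $f=\xi$ satisfies $f(X)+f(Y)\ge f(X\cap Y)+f(X\cup Y)$. Then $\xi$ is submodular on all subsets of $E$, and the proper amalgam of $M_1$ and $M_2$ along $M$ exists.
   Context: For $X\subseteq E$: $\eta(X)=\operatorname{rk}_1(X\cap E_1)+\operatorname{rk}_2(X\cap E_2)-\operatorname{rk}(X\cap T)$ and $\xi(X)=\min\{\eta(Y): X\subseteq Y\subseteq E\}$. $\mathcal{L}(M_1,M_2)$ is the set of all $X\subseteq E$ such that $X\cap E_1$ is a flat of $M_1$ and $X\cap E_2$ is a flat of $M_2$. When $\xi$ is submodular it is the rank function of a matroid on $E$ whose restriction to $E_i$ is $M_i$; this matroid is called the proper amalgam. *)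

(* Defs.v *)
From mathcomp Require Import all_boot all_order all_algebra finmap.
From mathcomp Require Import boolp classical_sets functions cardinality.

Set Implicit Arguments.
Unset Strict Implicit.
Unset Printing Implicit Defensive.

Import Order.TTheory GRing.Theory Num.Theory.

Local Open Scope classical_set_scope.
Local Open Scope ring_scope.

(* Matroids of finite rank on a possibly infinite ground set. Finite rank makes
   every independent set finite, which is why [indep] ranges over [{fset U}];
   arbitrary, possibly infinite, sets of elements have type [set U]. *)
Record matroid (U : choiceType) := Matroid {
  ground : set U ;
  indep : {fset U} -> Prop ;
  indep_ground : forall I, indep I -> [set` I] `<=` ground ;
  indep0 : indep fset0 ;
  indepS : forall I J, (I `<=` J)%fset -> indep J -> indep I ;
  indep_aug : forall I J, indep I -> indep J -> (#|` I| < #|` J|)%N ->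
    exists2 e, e \in (J `\` I)%fset & indep (e |` I)%fset ;
  indep_bounded : exists r, forall I, indep I -> (#|` I| <= r)%N
}.

(* The minimum (maximum) of a set; the junk value 0 when there is none. *)
Definition minimum (A : set int) : int := xget 0 (A `&` lbound A).
Definition maximum (A : set nat) : nat := xget 0%N (A `&` ubound A).

Definition rank (U : choiceType) (M : matroid U) (X : set U) : nat :=
  maximum [set #|` I|%N | I in [set I | indep M I /\ [set` I] `<=` X]].

Definition flat (U : choiceType) (M : matroid U) (X : set U) : Prop :=
  X `<=` ground M /\
  forall e, ground M e -> ~ X e -> (rank M X < rank M (X `|` [set e]))%N.

(* [N] is an extension of [M], i.e. [M] is the restriction of [N] to the ground
   set of [M]. *)
Definition extension (U : choiceType) (M N : matroid U) : Prop :=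
  ground M `<=` ground N /\
  forall I, indep M I <-> indep N I /\ [set` I] `<=` ground M.

Definition amalgam_eta (U : choiceType) (M M1 M2 : matroid U) (X : set U) : int :=
  (rank M1 (X `&` ground M1))%:Z + (rank M2 (X `&` ground M2))%:Z
  - (rank M (X `&` ground M))%:Z.

Definition amalgam_xi (U : choiceType) (M M1 M2 : matroid U) (X : set U) : int :=
  minimum [set amalgam_eta M M1 M2 Y | Y in
             [set Y | X `<=` Y /\ Y `<=` ground M1 `|` ground M2]].

Definition flat_pairs (U : choiceType) (M1 M2 : matroid U) : set (set U) :=
  [set X | [/\ X `<=` ground M1 `|` ground M2,
               flat M1 (X `&` ground M1) & flat M2 (X `&` ground M2)]].

Definition submodular_at (U : choiceType) (f : set U -> int) (X Y : set U) :
    Prop :=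
  f X + f Y >= f (X `&` Y) + f (X `|` Y).

Definition submodular_on (U : choiceType) (E : set U) (f : set U -> int) :
    Prop :=
  forall X Y, X `<=` E -> Y `<=` E -> submodular_at f X Y.

Definition amalgam (U : choiceType) (M1 M2 N : matroid U) : Prop :=
  [/\ ground N = ground M1 `|` ground M2, extension M1 N & extension M2 N].

Definition proper_amalgam (U : choiceType) (M M1 M2 N : matroid U) : Prop :=
  amalgam M1 M2 N /\
  forall X, X `<=` ground N -> (rank N X)%:Z = amalgam_xi M M1 M2 X.

(* Main.v *)
(* Each value of xi is attained by eta at an element of L(M1, M2), so the
   hypothesis on flats transfers to all pairs: if eta is submodular at the two
   chosen flats, bound xi by eta on their meet and join; if xi is, use in
   addition that xi is monotone. On an infinite ground set submodularity alone
   does not make xi the rank function of a matroid: one also needs that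
   xi(X + e) = xi(X) for all e in W implies xi(X + W) = xi(X). This holds because
   among the minimisers of eta above X there is a largest one, which contains
   all of W. *)
Require Import Defs.
From mathcomp Require Import all_boot all_order all_algebra finmap.
From mathcomp Require Import boolp classical_sets functions cardinality.
From mathcomp Require Import zify.

Set Implicit Arguments.
Unset Strict Implicit.
Unset Printing Implicit Defensive.

Import Order.TTheory GRing.Theory Num.Theory.

Local Open Scope classical_set_scope.
Local Open Scope ring_scope.

(** * Extrema of bounded sets of numbers *)

Lemma maximumP (A : set nat) (n : nat) :
  A !=set0 -> (forall x, A x -> (x <= n)%N) ->
  A (maximum A) /\ forall x, A x -> (x <= maximum A)%N.
Proof.
move=> [a Aa] leAn.
have exA : exists x, `[<A x>] by exists a; apply/asboolP.
have leA x : `[<A x>] -> (x <= n)%N by move/asboolP/leAn.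
have [m /asboolP Am maxm] := ex_maxnP exA leA.
rewrite /maximum; case: xgetP => [y _ [Ay uy]|/(_ m)[]].
  by split=> // x Ax; exact: uy.
by split=> // x Ax; apply: maxm; apply/asboolP.
Qed.

(** Nonnegative integers are naturals, so the well-ordering of [nat] supplies the least element. *)
Lemma minimumP (A : set int) :
  A !=set0 -> (forall x, A x -> 0 <= x) ->
  A (minimum A) /\ forall x, A x -> minimum A <= x.
Proof.
move=> [a Aa] A_ge0.
have exA : exists n : nat, `[<A n%:Z>].
  by exists (absz a); apply/asboolP; rewrite gez0_abs// A_ge0.
have [m /asboolP Am minm] := ex_minnP exA.
rewrite /minimum; case: xgetP => [y _ [Ay ly]|/(_ m%:Z)[]].
  by split=> // x Ax; exact: ly.
split=> // x Ax; have x_ge0 := A_ge0 _ Ax.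
by rewrite -(gez0_abs x_ge0) lez_nat minm//; apply/asboolP; rewrite gez0_abs.
Qed.

Lemma set_fset1U (U : choiceType) (e : U) (I : {fset U}) :
  [set` (e |` I)%fset] = [set` I] `|` [set e].
Proof.
apply/seteqP; split=> x /=; rewrite in_fset1U.
  by case/orP=> [/eqP|] ?; [right|left].
by case=> [->|->]; rewrite ?orbT ?eqxx.
Qed.

(** * Bases, rank and closure in a matroid of finite rank *)

Section Rank.
Variables (U : choiceType) (M : matroid U).
Implicit Types (X Y : set U) (I J : {fset U}).

Lemma rankP X :
  (exists I, [/\ indep M I, [set` I] `<=` X & #|` I| = rank M X]) /\
  forall I, indep M I -> [set` I] `<=` X -> (#|` I| <= rank M X)%N.
Proof.
have [n le_n] := indep_bounded M.
have [||[I [IM IX] cI] maxX] := @maximumP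
    [set #|` I|%N | I in [set I | indep M I /\ [set` I] `<=` X]] n.
- by exists 0%N; exists fset0; rewrite ?cardfs0//=; split=> //; exact: indep0.
- by move=> _ [I [IM _] <-]; exact: le_n.
by split=> [|J JM JX]; [exists I|apply: maxX; exists J].
Qed.

Lemma card_le_rank X I :
  indep M I -> [set` I] `<=` X -> (#|` I| <= rank M X)%N.
Proof. by case: (rankP X) => _; apply. Qed.

Lemma rankS X Y : X `<=` Y -> (rank M X <= rank M Y)%N.
Proof.
move=> XY; have [[I [IM IX <-]] _] := rankP X.
by apply: card_le_rank => //; exact: subset_trans XY.
Qed.

Lemma rank_setI_ground X : rank M (X `&` ground M) = rank M X.
Proof.
apply/eqP; rewrite eqn_leq rankS/=; last exact: subIsetl.
have [[I [IM IX <-]] _] := rankP X.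
by apply: card_le_rank => // x Ix; split; [exact: IX|exact: (indep_ground IM)].
Qed.

Lemma rank_le_card I : (rank M [set` I] <= #|` I|)%N.
Proof.
have [[J [_ JI <-]] _] := rankP [set` I].
by apply: fsubset_leq_card; apply/fsubsetP.
Qed.

Lemma indep_rank I : indep M I <-> rank M [set` I] = #|` I|.
Proof.
split=> [IM|rI].
  by apply/eqP; rewrite eqn_leq rank_le_card card_le_rank.
have [[J [JM JI cJ]] _] := rankP [set` I].
suff <- : J = I by [].
by apply/eqP; rewrite eqEfcard cJ rI leqnn andbT; apply/fsubsetP.
Qed.

(** Induction on the number of elements missing: augment [I] from any basis of [X]. *)
Lemma basis_extend X I : indep M I -> [set` I] `<=` X ->
  exists J, [/\ (I `<=` J)%fset, indep M J, [set` J] `<=` X &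
                #|` J| = rank M X].
Proof.
move: {2}(rank M X - #|` I|)%N (erefl (rank M X - #|` I|)%N) => n.
elim: n I => [|n IHn] I def_n IM IX.
  exists I; split=> //; have := card_le_rank IM IX; lia.
have [[B [BM BX cB]] _] := rankP X.
have [|e] := indep_aug IM BM; first by lia.
rewrite in_fsetD => /andP[eI eB] eIM.
have [|//||J [IJ JM JX cJ]] := IHn (e |` I)%fset.
- by rewrite cardfsU1 eI; lia.
- by rewrite set_fset1U => x [/IX|->] //; exact: BX.
by exists J; split=> //; exact: fsubset_trans (fsubsetUr _ _) IJ.
Qed.

(** Extend a basis [B] of the meet to a basis [J] of the join. The traces of [J] on [X] and [Y] are
    independent, cover [J] and share [B], so counting them suffices. *)
Lemma rank_submod X Y :
  (rank M (X `&` Y) + rank M (X `|` Y) <= rank M X + rank M Y)%N.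
Proof.
have [[B [BM BXY <-]] _] := rankP (X `&` Y).
have [|J [BJ JM JXY <-]] := @basis_extend (X `|` Y) B BM.
  by move=> x /BXY[]; left.
pose JX := [fset x in J | x \in X]%fset; pose JY := [fset x in J | x \in Y]%fset.
have leX : (#|` JX| <= rank M X)%N.
  apply: card_le_rank => [|x /=]; last by rewrite !inE => /andP[_ /set_mem].
  by apply: indepS JM; exact: fset_sub.
have leY : (#|` JY| <= rank M Y)%N.
  apply: card_le_rank => [|x /=]; last by rewrite !inE => /andP[_ /set_mem].
  by apply: indepS JM; exact: fset_sub.
have leB : (#|` B| <= #|` (JX `&` JY)%fset|)%N.
  apply: fsubset_leq_card; apply/fsubsetP => x xB.
  have [Xx Yx] := BXY _ xB; rewrite !inE (fsubsetP BJ _ xB)/=.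
  by apply/andP; split; exact/mem_set.
have leJ : (#|` J| <= #|` (JX `|` JY)%fset|)%N.
  apply: fsubset_leq_card; apply/fsubsetP => x xJ; rewrite !inE xJ/=.
  by case: (JXY _ xJ) => /mem_set ->; rewrite ?orbT.
have := cardfsUI JX JY; lia.
Qed.

Lemma rankU1 X (e : U) : (rank M (X `|` [set e]) <= (rank M X).+1)%N.
Proof.
have := rank_submod X [set e]; have := rank_le_card [fset e]%fset.
have -> : [set` [fset e]%fset] = [set e].
  by apply/seteqP; split=> x /=; rewrite in_fset1 => /eqP.
rewrite cardfs1; lia.
Qed.

(** [Y] may be infinite: were the rank to grow, augmenting a finite basis of [X] from one of the
    union would single out one element raising the rank of [X]. *)
Lemma rank_spanned X Y :
  (forall e, Y e -> rank M (X `|` [set e]) = rank M X) ->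
  rank M (X `|` Y) = rank M X.
Proof.
move=> spanY; apply/eqP; rewrite eqn_leq andbC rankS/=; last exact: subsetUl.
have [[B [BM BX cB]] _] := rankP X.
have [[J [JM JXY <-]] _] := rankP (X `|` Y).
rewrite leqNgt -cB; apply/negP => ltBJ.
have [e] := indep_aug BM JM ltBJ; rewrite in_fsetD => /andP[eB eJ] eBM.
have : (#|` (e |` B)%fset| <= rank M (X `|` [set e]))%N.
  by apply: card_le_rank => //; rewrite set_fset1U; exact: setSU.
have -> : rank M (X `|` [set e]) = rank M X.
  case: (JXY _ eJ) => [Xe|]; last exact: spanY.
  by congr rank; apply/setUidPl => _ ->.
rewrite cardfsU1 eB; lia.
Qed.

(** The closure operator. Elements outside the ground set never raise the rank, hence the explicit
    membership condition. *)
Definition span X : set U :=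
  [set e | ground M e /\ rank M (X `|` [set e]) = rank M X].

Lemma span_ground X : span X `<=` ground M.
Proof. by move=> e []. Qed.

Lemma sub_span X : X `&` ground M `<=` span X.
Proof.
by move=> e [Xe Me]; split=> //; congr rank; apply/setUidPl => _ ->.
Qed.

Lemma rank_span X : rank M (span X) = rank M X.
Proof.
apply/eqP; rewrite eqn_leq; apply/andP; split; last first.
  by rewrite -rank_setI_ground; apply: rankS; exact: sub_span.
rewrite -[leqRHS](@rank_spanned X (span X)).
  by apply: rankS; exact: subsetUr.
by move=> e [].
Qed.

Lemma flat_span X : flat M (span X).
Proof.
split=> [|e Me nXe]; first exact: span_ground.
rewrite rank_span.
have : (rank M X <= rank M (X `|` [set e]))%N by apply: rankS; exact: subsetUl.
have : (rank M (X `|` [set e]) <= rank M (span X `|` [set e]))%N.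
  rewrite -rank_setI_ground setIUl; apply: rankS.
  by apply: setUSS; [exact: sub_span|exact: subIsetl].
have : rank M (X `|` [set e]) <> rank M X by move=> eqr; apply: nXe.
lia.
Qed.

Lemma flat_max X Y : flat M X -> X `<=` Y -> Y `<=` ground M ->
  (rank M Y <= rank M X)%N -> Y `<=` X.
Proof.
move=> [XM Xflat] XY YM le_r e Ye; apply: contrapT => nXe.
have := Xflat e (YM _ Ye) nXe.
have : (rank M (X `|` [set e]) <= rank M Y)%N.
  by apply: rankS; rewrite subUset; split=> // _ ->.
lia.
Qed.

End Rank.

(** * Extensions in terms of rank *)

Lemma rank_extension (U : choiceType) (M N : matroid U) (X : set U) :
  extension M N -> X `<=` ground M -> rank N X = rank M X.
Proof.
move=> [_ extMN] XM; apply/eqP; rewrite eqn_leq; apply/andP; split.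
  have [[I [IN IX <-]] _] := rankP N X.
  by apply: card_le_rank => //; apply/extMN; split=> //; exact: subset_trans XM.
have [[I [IM IX <-]] _] := rankP M X.
by apply: card_le_rank => //; case/extMN: IM.
Qed.

(** By [indep_rank], independence can be read off the rank. *)
Lemma extension_rank (U : choiceType) (M N : matroid U) :
  ground M `<=` ground N ->
  (forall X, X `<=` ground M -> rank N X = rank M X) -> extension M N.
Proof.
move=> MN eqr; split=> // I; split=> [IM|[/indep_rank rI IM]].
  have IM' := indep_ground IM; split=> //.
  by apply/indep_rank; rewrite eqr//; apply/indep_rank.
by apply/indep_rank; rewrite -eqr.
Qed.

(** * Building a matroid from a rank function *)

Section MatroidOfRank.
Variables (U : choiceType) (E : set U) (f : set U -> int).
Hypothesis f0 : f set0 = 0.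
Hypothesis f_mono : forall X Y, X `<=` Y -> Y `<=` E -> f X <= f Y.
Hypothesis f_unit : forall X e, X `<=` E -> E e -> f (X `|` [set e]) <= f X + 1.
Hypothesis f_spanned : forall X Y, X `<=` E -> Y `<=` E ->
  (forall e, Y e -> f (X `|` [set e]) = f X) -> f (X `|` Y) = f X.

Let ind (I : {fset U}) : Prop := [set` I] `<=` E /\ f [set` I] = #|` I|%:Z.

Let fU_card X (I : {fset U}) :
  X `<=` E -> [set` I] `<=` E -> f (X `|` [set` I]) <= f X + #|` I|%:Z.
Proof.
move=> XE; elim/finSet_rect: I => I IHI IE.
have [->|[e eI]] := fset_0Vmem I; first by rewrite set_fset0 setU0 cardfs0; lia.
have ltI : (I `\ e `<` I)%fset by rewrite fproperD1.
have IeE : [set` (I `\ e)%fset] `<=` E.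
  by move=> x /=; rewrite in_fsetD1 => /andP[_ /IE].
have le1 := IHI _ ltI IeE.
rewrite (cardfsD1 e I) eI -{1}(fsetD1K eI) set_fset1U setUA.
have XIE : X `|` [set` (I `\ e)%fset] `<=` E by rewrite subUset.
have := f_unit XIE (IE _ eI); lia.
Qed.

Let f_card (I : {fset U}) : [set` I] `<=` E -> f [set` I] <= #|` I|%:Z.
Proof. by move=> /(fU_card (@sub0set _ E)); rewrite set0U f0; lia. Qed.

Let ind_ground I : ind I -> [set` I] `<=` E. Proof. by case. Qed.

Let ind0 : ind fset0.
Proof. by split; rewrite set_fset0 ?f0 ?cardfs0. Qed.

(** Since [f] gains at most one per element, a deficit on [I] could not be made up on the way to
    [J]. *)
Let indS (I J : {fset U}) : (I `<=` J)%fset -> ind J -> ind I.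
Proof.
move=> IJ [JE fJ].
have IE : [set` I] `<=` E by move=> x /= /(fsubsetP IJ)/JE.
have JIE : [set` (J `\` I)%fset] `<=` E.
  by move=> x /=; rewrite in_fsetD => /andP[_ /JE].
split=> //; have := fU_card IE JIE; have := f_card IE.
have -> : [set` I] `|` [set` (J `\` I)%fset] = [set` J].
  apply/seteqP; split=> x /=.
    by rewrite in_fsetD => -[/(fsubsetP IJ)//|/andP[]].
  by rewrite in_fsetD; case: (x \in I) => xJ; [left|right].
have := cardfsID I J; rewrite (fsetIidPr IJ) fJ; lia.
Qed.

(** Each single element of [X] changes [f] by 0 or 1, and a gain of 1 would enlarge [I]. So no
    element changes it, and [f_spanned] passes to all of [X] at once. *)
Let ind_max_f (I : {fset U}) X : ind I -> [set` I] `<=` X -> X `<=` E ->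
  (forall e, X e -> e \notin I -> ~ ind (e |` I)%fset) -> f X = #|` I|%:Z.
Proof.
move=> [IE fI] IX XE maxI; rewrite -fI -(setUidr IX).
apply: f_spanned => // e Xe.
have [eI|eI] := boolP (e \in I).
  by congr f; apply/setUidPl => _ ->.
have Ee := XE _ Xe; have := f_unit IE Ee.
have : f [set` I] <= f ([set` I] `|` [set e]).
  by apply: f_mono; [exact: subsetUl|rewrite subUset; split=> // _ ->].
suff : f ([set` I] `|` [set e]) <> f [set` I] + 1 by lia.
move=> fe; apply: (maxI e) => //; split.
  by rewrite set_fset1U subUset; split=> // _ ->.
by rewrite set_fset1U fe fI cardfsU1 eI; lia.
Qed.

(** Without augmentation [I] is maximal in the union with [J], so [f] there equals the size of [I],
    which is less than [f] of [J]. *)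
Let ind_aug (I J : {fset U}) : ind I -> ind J -> (#|` I| < #|` J|)%N ->
  exists2 e, e \in (J `\` I)%fset & ind (e |` I)%fset.
Proof.
move=> iI iJ ltIJ; apply: contrapT => noaug.
have IJE : [set` I] `|` [set` J] `<=` E.
  by rewrite subUset; split; exact: ind_ground.
suff : f ([set` I] `|` [set` J]) = #|` I|%:Z.
  have := f_mono (@subsetUr _ [set` I] [set` J]) IJE.
  by case: iJ => _ ->; lia.
apply: ind_max_f => //.
move=> e [/= ->//|/= eJ] eI ieI; apply: noaug; exists e => //.
by rewrite in_fsetD eI.
Qed.

Let ind_le (I : {fset U}) X : ind I -> [set` I] `<=` X -> X `<=` E ->
  (#|` I| <= absz (f X))%N.
Proof. by move=> [_ fI] IX XE; have := f_mono IX XE; rewrite fI; lia. Qed.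

(** The condition [f_spanned] takes the place of submodularity and covers infinite sets. *)
Lemma matroid_of_rank : exists N : matroid U, ground N = E /\
  forall X, X `<=` E -> (rank N X)%:Z = f X.
Proof.
have ind_bounded : exists r, forall I, ind I -> (#|` I| <= r)%N.
  by exists (absz (f E)) => I iI; apply: ind_le => //; exact: ind_ground.
exists (Matroid ind_ground ind0 indS ind_aug ind_bounded); split=> // X XE.
set N := Matroid _ _ _ _ _; have [[I [/= iI IX cI]] maxI] := rankP N X.
rewrite -cI; apply/esym/ind_max_f => // e Xe eI ieI.
have := maxI _ ieI; rewrite set_fset1U subUset cardfsU1 eI -cI => leI.
suff /leI : [set` I] `<=` X /\ [set e] `<=` X by lia.
by split=> // _ ->.
Qed.

End MatroidOfRank.

(** * Comparing ranks in a matroid and its extension *)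

Lemma rank_extension_le (U : choiceType) (M N : matroid U) (X : set U) :
  extension M N -> (rank M X <= rank N X)%N.
Proof.
move=> extMN; rewrite -rank_setI_ground.
rewrite -(rank_extension extMN (@subIsetr _ X (ground M))).
by apply: rankS; exact: subIsetl.
Qed.

Lemma rank_extensionI (U : choiceType) (M N : matroid U) (X : set U) :
  extension M N -> X `&` ground N `<=` ground M -> rank N X = rank M X.
Proof.
move=> extMN XNM; apply/eqP; rewrite eqn_leq (rank_extension_le _ extMN) andbT.
by rewrite -rank_setI_ground (rank_extension extMN)// rankS//; exact: subIsetl.
Qed.

(** Diminishing returns: [e] adds no more to the larger set [X] than to its trace on [ground M].
    This is submodularity in [N] of [X] and the trace [Xe]. *)
Lemma rankU1_extension (U : choiceType) (M N : matroid U) (X : set U) (e : U) :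
  extension M N -> ground M e ->
  (rank N (X `|` [set e]) + rank M X
     <= rank N X + rank M (X `|` [set e]))%N.
Proof.
move=> extMN Me; pose Xe := (X `|` [set e]) `&` ground M.
rewrite -(rank_setI_ground M X) -(rank_setI_ground M (X `|` [set e])).
rewrite -!(rank_extension extMN); [|exact: subIsetr|exact: subIsetr].
have := rank_submod N X Xe.
have : (rank N (X `&` ground M) <= rank N (X `&` Xe))%N.
  by apply: rankS => x [Xx Mx]; split=> //; split=> //; left.
have : (rank N (X `|` [set e]) <= rank N (X `|` Xe))%N.
  by apply: rankS => x [Xx|->]; [left|right; split=> //; right].
rewrite -/Xe; lia.
Qed.

Lemma rankU1_notin (U : choiceType) (M : matroid U) (X : set U) (e : U) :
  ~ ground M e -> rank M (X `|` [set e]) = rank M X.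
Proof.
move=> Me; rewrite -rank_setI_ground -[RHS]rank_setI_ground setIUl.
by congr rank; apply/setUidPl => x [-> /Me].
Qed.

(** * The functions [eta] and [xi] and their minimisers *)

Section Amalgam.
Variables (U : choiceType) (M M1 M2 : matroid U).
Hypotheses (ext1 : extension M M1) (ext2 : extension M M2).
Hypothesis groundI : ground M1 `&` ground M2 = ground M.
Local Notation E := (ground M1 `|` ground M2).
Local Notation eta := (amalgam_eta M M1 M2).
Local Notation xi := (amalgam_xi M M1 M2).
Implicit Types X Y Z W : set U.

Let etaE X : eta X = (rank M1 X)%:Z + (rank M2 X)%:Z - (rank M X)%:Z.
Proof. by rewrite /amalgam_eta !rank_setI_ground. Qed.

Let eta_ge X : (rank M1 X)%:Z <= eta X /\ (rank M2 X)%:Z <= eta X.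
Proof.
have := rank_extension_le X ext1; have := rank_extension_le X ext2.
rewrite etaE; lia.
Qed.

(** If [e] lies in both ground sets, its gain in [M1] is absorbed by the gain in [M], which is
    subtracted; only the gain in [M2] is left. *)
Lemma etaU1 X (e : U) : eta (X `|` [set e]) <= eta X + 1.
Proof.
have incr := rankS _ (@subsetUl _ X [set e]).
have := incr M; have := rankU1 M1 X e; have := rankU1 M2 X e; rewrite !etaE.
have [Me|/(rankU1_notin X) ->] := pselect (ground M2 e); last by lia.
have [M1e|/(rankU1_notin X) ->] := pselect (ground M1 e); last by lia.
have := rankU1_extension X ext1; rewrite -groundI => /(_ _ (conj M1e Me)); lia.
Qed.

Let minimizer X Y := [/\ X `<=` Y, Y `<=` E & eta Y = xi X].
(** A tie-breaker among minimisers: [eta] can stay constant while the ranks grow, because the rank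
    in [M] is subtracted. *)
Let s Y := (rank M1 Y + rank M2 Y)%N.

Lemma xiP X : X `<=` E ->
  (exists Y, [/\ X `<=` Y, Y `<=` E & eta Y = xi X]) /\
  forall Y, X `<=` Y -> Y `<=` E -> xi X <= eta Y.
Proof.
move=> XE.
have [||[Y [XY YE] eY] minY] := @minimumP
    [set eta Y | Y in [set Y | X `<=` Y /\ Y `<=` E]].
- by exists (eta X), X => //; split.
- by move=> _ [Y _ <-]; have [] := eta_ge Y; lia.
split; first by exists Y; split.
by move=> Z XZ ZE; apply: minY; exists Z.
Qed.

Lemma xi_le X Y : X `<=` Y -> Y `<=` E -> xi X <= eta Y.
Proof.
by move=> XY YE; have [_] := xiP (subset_trans XY YE); apply.
Qed.

Lemma xi_mono X Y : X `<=` Y -> Y `<=` E -> xi X <= xi Y.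
Proof.
move=> XY YE; have [[Z [YZ ZE <-]] _] := xiP YE.
by apply: xi_le => //; exact: subset_trans YZ.
Qed.

Lemma xiU1 X (e : U) : X `<=` E -> E e -> xi (X `|` [set e]) <= xi X + 1.
Proof.
move=> XE Ee; have [[Y [XY YE <-]] _] := xiP XE.
apply: le_trans (etaU1 Y e); apply: xi_le; first exact: setSU.
by rewrite subUset; split=> // _ ->.
Qed.

(** Any minimiser has [eta] at least its rank in either extension. The bound is attained at [X]
    itself, where the other two ranks cancel. *)
Lemma xi_rank X :
  (X `<=` ground M1 -> xi X = (rank M1 X)%:Z) /\
  (X `<=` ground M2 -> xi X = (rank M2 X)%:Z).
Proof.
split=> XG.
- have XE : X `<=` E by move=> x /XG; left.
  have [[Y [XY _ eY]] _] := xiP XE; have [leY _] := eta_ge Y.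
  have := xi_le (@subset_refl _ X) XE; have := rankS M1 XY.
  rewrite etaE (rank_extensionI ext2); first by lia.
  by rewrite -groundI; exact: setSI.
- have XE : X `<=` E by move=> x /XG; right.
  have [[Y [XY _ eY]] _] := xiP XE; have [_ leY] := eta_ge Y.
  have := xi_le (@subset_refl _ X) XE; have := rankS M2 XY.
  rewrite etaE (rank_extensionI ext1); first by lia.
  by rewrite -groundI setIC; exact: setIS.
Qed.

(* A minimiser of largest total rank cannot distinguish the closures of [M1]
   and [M2] on their common part, so the union of the two closures is again a
   minimiser, and its traces on both ground sets are flats. *)
Lemma flat_minimizer X : X `<=` E ->
  exists Y, [/\ minimizer X Y, flat_pairs M1 M2 Y &
    forall Z, minimizer X Z -> (s Z <= s Y)%N].
Proof.
move=> XE; have [[Y0 minY0] _] := xiP XE.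
have [||[Y minY eY] maxY] := @maximumP [set s Y | Y in minimizer X] (s E).
- by exists (s Y0), Y0.
- by move=> _ [Z [_ ZE _] <-]; apply: leq_add; exact: rankS.
have {eY}maxY Z : minimizer X Z -> (s Z <= s Y)%N.
  by move=> minZ; rewrite eY; apply: maxY; exists Z.
have [XY YE eY] := minY.
(* If exactly one rank grew with [e], the rank in [M] would grow too. Then [eta] would not increase,
   and adding [e] would give a minimiser with larger [s]. *)
have spanE e : ground M e -> rank M1 (Y `|` [set e]) = rank M1 Y \/
    rank M2 (Y `|` [set e]) = rank M2 Y ->
    rank M1 (Y `|` [set e]) = rank M1 Y /\ rank M2 (Y `|` [set e]) = rank M2 Y.
  move=> Me eqr; have YeE : Y `|` [set e] `<=` E.
    by rewrite subUset; split=> // _ ->; left; apply: ext1.1.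
  have XYe : X `<=` Y `|` [set e] by move=> x /XY; left.
  have := xi_le XYe YeE.
  have incr := rankS _ (@subsetUl _ Y [set e]).
  have := incr M1; have := incr M2; have maxYe := maxY (Y `|` [set e]).
  have := rankU1_extension Y ext1 Me; have := rankU1_extension Y ext2 Me.
  have := etaE Y; have := etaE (Y `|` [set e]); rewrite /s in maxYe * => *.
  have /maxYe : minimizer X (Y `|` [set e]) by split=> //; lia.
  lia.
pose Z := span M1 Y `|` span M2 Y.
have Z1 : Z `&` ground M1 = span M1 Y.
  apply/seteqP; split=> e; last by move=> Ye; split; [left|exact: span_ground Ye].
  move=> [[//|[M2e eqr]] M1e]; split=> //.
  by case: (spanE e) => //; [rewrite -groundI|right].
have Z2 : Z `&` ground M2 = span M2 Y.
  apply/seteqP; split=> e; last by move=> Ye; split; [right|exact: span_ground Ye].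
  move=> [[[M1e eqr]|//] M2e]; split=> //.
  by case: (spanE e) => //; [rewrite -groundI|left].
have r1 : rank M1 Z = rank M1 Y by rewrite -rank_setI_ground Z1 rank_span.
have r2 : rank M2 Z = rank M2 Y by rewrite -rank_setI_ground Z2 rank_span.
have YZ : Y `<=` Z.
  by move=> e Ye; case: (YE e Ye) => Me; [left|right]; exact: sub_span.
have ZE : Z `<=` E by apply: setUSS; exact: span_ground.
have XZ := subset_trans XY YZ.
exists Z; split.
(* Passing to [Z] keeps both outer ranks and cannot lower the subtracted rank in [M], so [eta] does
   not increase. *)
- split=> //; have := xi_le XZ ZE; have := rankS M YZ.
  move: eY; rewrite !etaE r1 r2; lia.
- by split=> //; rewrite ?Z1 ?Z2; exact: flat_span.
- by move=> W /maxY; rewrite /s r1 r2.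
Qed.

(** * Submodularity of [xi] and existence of the proper amalgam *)

Hypothesis submod : forall X Y,
  flat_pairs M1 M2 X -> flat_pairs M1 M2 Y ->
  submodular_at eta X Y \/ submodular_at xi X Y.

Lemma xi_submodular : submodular_on E xi.
Proof.
move=> X Y XE YE.
have [X' [[XX' X'E eX'] LX' _]] := flat_minimizer XE.
have [Y' [[YY' Y'E eY'] LY' _]] := flat_minimizer YE.
have UE : X' `|` Y' `<=` E by rewrite subUset.
have IE : X' `&` Y' `<=` E by move=> x [/X'E].
rewrite /submodular_at -eX' -eY'.
have [|] := submod LX' LY'; rewrite /submodular_at.
  have := xi_le (setISS XX' YY') IE; have := xi_le (setUSS XX' YY') UE; lia.
have := xi_mono (setISS XX' YY') IE; have := xi_mono (setUSS XX' YY') UE.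
(* In this case the right-hand side has [xi] at [X'] and [Y'], which is at most [eta] there. *)
have := xi_le (@subset_refl _ X') X'E; have := xi_le (@subset_refl _ Y') Y'E.
lia.
Qed.

(* Submodularity makes the flat minimiser of largest total rank contain every
   other minimiser over [X]; this replaces the passage to the limit over finite
   subsets when [W] is infinite. *)
Lemma xi_spanned X W : X `<=` E -> W `<=` E ->
  (forall e, W e -> xi (X `|` [set e]) = xi X) -> xi (X `|` W) = xi X.
Proof.
move=> XE WE spanW; have [Y [[XY YE eY] [_ F1 F2] maxY]] := flat_minimizer XE.
suff WY : W `<=` Y.
  apply: le_anti; rewrite -{1}eY xi_le ?subUset//=.
  by apply: xi_mono; [exact: subsetUl|rewrite subUset].
move=> e We; have XeE : X `|` [set e] `<=` E.
  by rewrite subUset; split=> // _ ->; exact: WE.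
have [[Y1 [XeY1 Y1E eY1]] _] := xiP XeE; rewrite spanW// in eY1.
have XY1 : X `<=` Y1 by apply: subset_trans XeY1; exact: subsetUl.
have UE : Y `|` Y1 `<=` E by rewrite subUset.
have [[Z [UZ ZE eZ]] _] := xiP UE.
have YZ : Y `<=` Z by apply: subset_trans UZ; exact: subsetUl.
have XZ := subset_trans XY YZ.
(* Both [Y] and [Y1] have [eta] equal to [xi X], and their meet has [xi] at least [xi X].
   Submodularity then leaves at most [xi X] for their join, whose [xi] is [eta Z]. *)
have /maxY : minimizer X Z.
  split=> //; have := xi_submodular YE Y1E; rewrite /submodular_at.
  have := xi_le (@subset_refl _ Y) YE; have := xi_le (@subset_refl _ Y1) Y1E.
  have XI : X `<=` Y `&` Y1 by rewrite subsetI.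
  have IE : Y `&` Y1 `<=` E by move=> x [/YE].
  have := xi_mono XI IE; have := xi_le XZ ZE; lia.
(* Maximality of [s] makes both ranks of [Z] equal those of [Y]. As the traces of [Y] are flats, [Z]
   adds nothing to them, so [e] is already in [Y]. *)
have := rankS M1 YZ; have := rankS M2 YZ; rewrite /s => le2 le1 les.
have Ze : Z e by apply/UZ; right; apply/XeY1; right.
have [M1e|M2e] := ZE _ Ze.
- have [||//] := flat_max F1 (setSI YZ) _ _ (conj Ze M1e).
    exact: subIsetr.
  rewrite !rank_setI_ground; lia.
- have [||//] := flat_max F2 (setSI YZ) _ _ (conj Ze M2e).
    exact: subIsetr.
  rewrite !rank_setI_ground; lia.
Qed.

(** The matroid with rank [xi] extends [M1] and [M2] because, by [xi_rank], its rank agrees with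
    theirs on each ground set. *)
Lemma proper_amalgam_exists : exists N : matroid U, proper_amalgam M M1 M2 N.
Proof.
have xi0 : xi set0 = 0.
  have [-> //] := xi_rank set0.
  have := rank_le_card M1 fset0; rewrite cardfs0 set_fset0; lia.
have [N [groundN rankN]] := matroid_of_rank xi0 xi_mono xiU1 xi_spanned.
have sub1 : ground M1 `<=` E by move=> x; left.
have sub2 : ground M2 `<=` E by move=> x; right.
exists N; split; last by rewrite groundN.
split=> //; apply: extension_rank; rewrite ?groundN// => X XG.
- have [/(_ XG) eX _] := xi_rank X.
  by have := rankN X (subset_trans XG sub1); rewrite eX => -[].
- have [_ /(_ XG) eX] := xi_rank X.
  by have := rankN X (subset_trans XG sub2); rewrite eX => -[].
Qed.

End Amalgam.

Theorem theorem15 (U : choiceType) (M M1 M2 : matroid U)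
    (ext1 : extension M M1) (ext2 : extension M M2)
    (groundI : ground M1 `&` ground M2 = ground M)
    (count0 : countable (ground M))
    (count1 : countable (ground M1)) (count2 : countable (ground M2))
    (submod : forall X Y : set U,
       flat_pairs M1 M2 X -> flat_pairs M1 M2 Y ->
       submodular_at (amalgam_eta M M1 M2) X Y \/ submodular_at (amalgam_xi M M1 M2) X Y) :
  submodular_on (ground M1 `|` ground M2) (amalgam_xi M M1 M2) /\
  exists N : matroid U, proper_amalgam M M1 M2 N.
Proof.
split; first exact: xi_submodular.
exact: proper_amalgam_exists.
Qed.
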